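(* Let $k\ge 2$ and let $\mathcal{L}=\{l_1,l_2,\dots,l_s\}$ be a set of $s$ nonnegative integers with $l_1<l_2<\dots<l_s$. Suppose that $\mathcal{A}=\{A_1,\dots,A_m\}$ is a family of (distinct) subsets of $[n]$ such that $|A_{i_1}\cap A_{i_2}\cap\dots\cap A_{i_k}|\in\mathcal{L}$ for every collection of $k$ distinct subsets in $\mathcal{A}$. Let $h$ be the maximum subset size in $\mathcal{A}$. If $n\ge\left[\binom{h^2+h}{l_1+1}+1\right]s+l_1$, then \[ m\le (k-1)\left[\binom{n-l_1}{s}+\binom{n-l_1}{s-1}+\cdots+\binom{n-l_1}{0}\right]. \]
   Context: $\binom{a}{b}$ denotes the usual binomial coefficient. *)

(* Defs.v *)
From mathcomp Require Import all_boot.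

Set Implicit Arguments.
Unset Strict Implicit.
Unset Printing Implicit Defensive.

(* Sets of k pairwise distinct members of F are the k-element subsets of F. *)
Definition kwise_intersecting (n k : nat) (L : seq nat)
    (F : {set {set 'I_n}}) : Prop :=
  forall B : {set {set 'I_n}}, B \subset F -> #|B| = k ->
    #|\bigcap_(A in B) A| \in L.

(* Equals 0 for the empty family. *)
Definition max_size (n : nat) (F : {set {set 'I_n}}) : nat :=
  \max_(A in F) #|A|.

(* Main.v *)
(* A k-wise L-intersecting family F whose members all contain a set S has at most
   (k - 1) * \sum_(i <= |L|) 'C(n - |S|, i) members: F is peeled off in groups of
   at most k - 1 sets, each group giving a pair (A, B) with B a subset of A such
   that |B :&: H| lies in L and is < |B| for all sets H remaining afterwards; the
   corresponding polynomials of degree at most |L| in n - |S| variables are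
   linearly independent by triangularity.
   If the intersection of F has at least l1 points, take for S an l1-subset of
   it. Otherwise at most h + 1 members of F already have the same intersection
   as F; their union T has at most h ^ 2 + h points, and every member of F meets
   T in more than l1 points. So F is covered by 'C(|T|, l1 + 1) subfamilies, each
   with a common (l1 + 1)-subset S and L without l1, and the hypothesis on n
   absorbs the factor 'C(h ^ 2 + h, l1 + 1). *)
Require Import Defs.
From mathcomp Require Import all_boot all_algebra.
From mathcomp Require Import zify.

Set Implicit Arguments.
Unset Strict Implicit.
Unset Printing Implicit Defensive.

Import GRing.Theory Num.Theory.

(** * Counting and extending finite subsets *)

Section SmallSubsets.
Variable T : finType.
Implicit Types (A D I : {set T}).

Definition small_subsets D d : {set {set T}} :=
  [set I : {set T} | I \subset D & #|I| <= d].

Lemma card_small_subsets D d :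
  #|small_subsets D d| = \sum_(0 <= i < d.+1) 'C(#|D|, i).
Proof.
elim: d => [|d IHd].
  rewrite big_nat1 -cards_draws; apply: eq_card => I.
  by rewrite !inE leqn0.
rewrite big_nat_recr //= -IHd -cards_draws -[RHS]cardsUI.
rewrite [X in _ = _ + X](_ : _ = 0); last first.
  apply: eq_card0 => I; rewrite !inE; lia.
rewrite addn0; apply: eq_card => I; rewrite !inE; lia.
Qed.

Lemma subset_card_extension A D k :
  A \subset D -> #|A| <= k <= #|D| ->
  exists B : {set T}, [/\ A \subset B, B \subset D & #|B| = k].
Proof.
move=> sAD /andP[leAk lekD].
have /card_geqP[s [us szs sD]] : k - #|A| <= #|D :\: A|.
  by rewrite cardsDS // leq_sub2r.
exists (A :|: [set:: s]); split; first exact: subsetUl.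
  rewrite subUset sAD /=; apply/subsetP => x; rewrite inE => /sD.
  by rewrite inE => /andP[].
rewrite cardsU disjoint_setI0; last first.
  rewrite -setI_eq0; apply/eqP/setP=> x; rewrite !inE.
  have [/sD|_] := boolP (x \in s); last by rewrite andbF.
  by rewrite inE => /andP[/negbTE->].
have -> : #|[set:: s]| = size s.
  by rewrite -(card_uniqP us); apply: eq_card => x; rewrite inE.
by rewrite cards0 subn0 szs subnKC.
Qed.

End SmallSubsets.

(** * Multilinear functions of bounded degree and the rank bound *)

Section MultilinearPolynomials.
Variables (T : finType) (S : {set T}).
Implicit Types (f g : {set T} -> rat) (B I x : {set T}) (d : nat) (L : seq nat).
Local Open Scope ring_scope.

(** [(I \subset x)%:R] is the monomial of [I] evaluated at the indicator vector of [x]. Only sets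
    [x] containing [S] matter, which fixes the variables in [S] to 1 and leaves those in [~: S]. *)
Definition degree_le d f := exists c : {set T} -> rat,
  forall x, S \subset x ->
    f x = \sum_(I in small_subsets (~: S) d) c I * (I \subset x)%:R.

Lemma eq_degree_le d f g :
  (forall x, S \subset x -> f x = g x) -> degree_le d f -> degree_le d g.
Proof. by move=> fg [c fE]; exists c => x Sx; rewrite -fg // fE. Qed.

Lemma degree_leZ d a f : degree_le d f -> degree_le d (fun x => a * f x).
Proof.
case=> c fE; exists (fun I => a * c I) => x Sx; rewrite fE // mulr_sumr.
by apply: eq_bigr => I _; rewrite mulrA.
Qed.

Lemma degree_leD d f g :
  degree_le d f -> degree_le d g -> degree_le d (fun x => f x + g x).
Proof.
case=> c fE [e gE]; exists (fun I => c I + e I) => x Sx.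
by rewrite fE // gE // -big_split; apply: eq_bigr => I _; rewrite mulrDl.
Qed.

Lemma degree_le_sum d (J : finType) (P : pred J) (F : J -> {set T} -> rat) :
  (forall j, P j -> degree_le d (F j)) ->
  degree_le d (fun x => \sum_(j | P j) F j x).
Proof.
move=> dF; suff H (r : seq J) : degree_le d (fun x => \sum_(j <- r | P j) F j x).
  exact: H.
elim: r => [|j r IHr].
  by exists (fun=> 0) => x _; rewrite big_nil big1 // => I _; rewrite mul0r.
case: (boolP (P j)) => Pj.
  by apply: eq_degree_le (degree_leD (dF j Pj) IHr) => x _; rewrite big_cons Pj.
by apply: eq_degree_le IHr => x _; rewrite big_cons (negbTE Pj).
Qed.

Lemma degree_le_monomial d I :
  (#|I :\: S| <= d)%N -> degree_le d (fun x => (I \subset x)%:R).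
Proof.
(* On supersets of [S], the monomials of [I] and of [I :\: S] agree. *)
move=> leId; exists (fun J => (J == I :\: S)%:R) => x Sx.
rewrite (bigD1 (I :\: S)) /=; last by rewrite inE leId setDE subsetIr.
rewrite eqxx mul1r big1 ?addr0; last first.
  by move=> J /andP[_ /negbTE->]; rewrite mul0r.
by rewrite subDset (setUidPr Sx).
Qed.

Lemma degree_le_trans d e f : (d <= e)%N -> degree_le d f -> degree_le e f.
Proof.
move=> led [c fE].
apply: (@eq_degree_le e
  (fun x => \sum_(I in small_subsets (~: S) d) c I * (I \subset x)%:R)).
  by move=> x Sx; rewrite fE.
apply: degree_le_sum => I; rewrite inE => /andP[_ leI].
apply/degree_leZ/degree_le_monomial/(leq_trans _ led)/(leq_trans _ leI).
by rewrite subset_leq_card // subsetDl.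
Qed.

(** Indicator variables are idempotent, so multiplying by that of [b] turns the monomial of [I] into
    that of [b |: I]. *)
Lemma degree_le_mul_mem d f b :
  degree_le d f -> degree_le d.+1 (fun x => f x * (b \in x)%:R).
Proof.
case=> c fE.
apply: (@eq_degree_le _ (fun x =>
  \sum_(I in small_subsets (~: S) d) c I * ((b |: I) \subset x)%:R)).
  move=> x Sx; rewrite fE // mulr_suml; apply: eq_bigr => I _.
  by rewrite subUset sub1set -mulrA -natrM mulnb andbC.
apply: degree_le_sum => I; rewrite inE => /andP[_ leI].
apply/degree_leZ/degree_le_monomial.
apply: leq_trans (subset_leq_card (subsetDl _ _)) _.
by rewrite cardsU1; case: (b \in I) => /=; lia.
Qed.

Lemma degree_le_mul_card d f B a : degree_le d f ->
  degree_le d.+1 (fun x => f x * (#|B :&: x|%:R - a)).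
Proof.
move=> df; have dfa := degree_le_trans (leqnSn d) (degree_leZ (- a) df).
have dfB : degree_le d.+1 (fun x => \sum_(b in B) f x * (b \in x)%:R).
  by apply: degree_le_sum => b _; apply: degree_le_mul_mem.
apply: eq_degree_le (degree_leD dfB dfa) => x _.
rewrite mulrBr -mulr_sumr mulNr [a * _]mulrC.
congr (_ * _ - _); rewrite -natr_sum; congr _%:R.
rewrite -sum1_card [RHS](eq_bigl _ _ (fun b => in_setI b B x)).
by rewrite [RHS]big_mkcondr; apply: eq_bigr => b _; case: (b \in x).
Qed.

Lemma degree_le_intersection_poly L (P : pred nat) B :
  degree_le (size L) (fun x => \prod_(l <- L | P l) (#|B :&: x|%:R - l%:R)).
Proof.
elim: L => [|l L IHL] /=.
  apply: (@eq_degree_le _ (fun x => (set0 \subset x)%:R)).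
    by move=> x _; rewrite big_nil sub0set.
  by apply: degree_le_monomial; rewrite set0D cards0.
case: (boolP (P l)) => Pl.
  apply: eq_degree_le (degree_le_mul_card B l%:R IHL) => x _.
  by rewrite big_cons Pl mulrC.
apply: eq_degree_le (degree_le_trans (leqnSn _) IHL) => x _.
by rewrite big_cons (negbTE Pl).
Qed.

(** The matrix of values [f i (A j)] is triangular with nonzero diagonal, hence of rank [m], and it
    factors through the space spanned by the monomials. *)
Lemma triangular_family_bound d m (f : 'I_m -> {set T} -> rat)
    (A : 'I_m -> {set T}) :
  (forall i, degree_le d (f i)) -> (forall i, S \subset A i) ->
  (forall i, f i (A i) != 0) ->
  (forall i j : 'I_m, (i < j)%N -> f i (A j) = 0) ->
  (m <= \sum_(0 <= i < d.+1) 'C(#|~: S|, i))%N.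
Proof.
move=> df SA fii fij.
have /fin_all_exists[c fE] := df.
pose V := small_subsets (~: S) d.
pose M := \matrix_(i < m, j < m) f i (A j).
pose C := \matrix_(i < m, I < #|V|) c i (enum_val I).
pose E : 'M[rat]_(#|V|, m) :=
  \matrix_(I < #|V|, j < m) ((enum_val I : {set T}) \subset A j)%:R.
have ME : M = C *m E.
  apply/matrixP => i j; rewrite !mxE (fE i) // big_enum_val /=.
  by apply: eq_bigr => I _; rewrite !mxE.
have Munit : M \in unitmx.
  rewrite unitmxE det_trig; last first.
    by apply/is_trig_mxP => i j ij; rewrite mxE fij.
  rewrite unitfE; apply/prodf_neq0 => i _; by rewrite mxE.
by rewrite -card_small_subsets -(mxrank_unit Munit) ME mulmx_max_rank.
Qed.

(* The polynomial attached to a pair (A, B) is the product of |B :&: x| - l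
   over the l in L with l < |B|; it does not vanish at x = A. *)
Lemma triangular_pairs_bound L (ps : seq ({set T} * {set T})) :
  all (fun p : {set T} * {set T} => (S \subset p.1) && (p.2 \subset p.1)) ps ->
  pairwise (fun p q : {set T} * {set T} => (#|p.2 :&: q.1| \in L)
             && (#|p.2 :&: q.1| < #|p.2|)%N) ps ->
  (size ps <= \sum_(0 <= i < (size L).+1) 'C(#|~: S|, i))%N.
Proof.
move=> /all_nthP Sps /(pairwiseP (set0, set0)) pps.
pose p i := nth (set0, set0) ps i.
apply: (@triangular_family_bound _ _ (fun i x =>
   \prod_(l <- L | (l < #|(p i).2|)%N) (#|(p i).2 :&: x|%:R - l%:R))
   (fun i => (p i).1)).
- by move=> i; apply: degree_le_intersection_poly.
- by move=> i; have /andP[] := Sps (set0, set0) i (ltn_ord i).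
- move=> i; have /andP[_ /setIidPl->] := Sps (set0, set0) i (ltn_ord i).
  rewrite prodf_seq_neq0; apply/allP => l _; apply/implyP => ltl.
  by rewrite subr_eq0 eqr_nat gtn_eqF.
move=> i j ij; have /andP[inL lt] := pps i j (ltn_ord i) (ltn_ord j) ij.
apply/eqP; rewrite prodf_seq_eq0; apply/hasP.
by exists #|(p i).2 :&: (p j).1|; rewrite // lt subrr eqxx.
Qed.

End MultilinearPolynomials.

(** * Peeling and covering of k-wise intersecting families *)

Section KwiseIntersecting.
Variables (n k : nat).
Implicit Types (A B S T : {set 'I_n}) (F G : {set {set 'I_n}}) (L : seq nat)
  (p q : {set 'I_n} * {set 'I_n}).

Lemma kwise_intersectingS L F G :
  G \subset F -> kwise_intersecting k L F -> kwise_intersecting k L G.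
Proof. by move=> sGF FL B sBG; apply: FL; apply: subset_trans sGF. Qed.

Lemma kwise_intersecting_sub L G F :
  kwise_intersecting k L F -> G \subset F -> #|G| <= k <= #|F| ->
  exists2 l, l \in L & l <= #|\bigcap_(A in G) A|.
Proof.
move=> FL sGF kG; have [B [sGB sBF cB]] := subset_card_extension sGF kG.
exists #|\bigcap_(A in B) A|; first exact: FL.
by apply/subset_leq_card/bigcapsP => A /(subsetP sGB); apply: bigcap_inf.
Qed.

(* Choose G minimizing the size of its intersection B among the nonempty
   subfamilies for which fewer than k members of F contain B; if H in F does
   not contain B, then by minimality B :&: H lies in at least k members of F,
   so that it is the intersection of exactly k of them. *)
Lemma critical_subfamily L F :
  2 <= k -> kwise_intersecting k L F -> F != set0 ->
  exists G, let B := \bigcap_(A in G) A in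
    [/\ G \subset F, G != set0, #|G| <= k - 1 &
        forall H, H \in F :\: G -> (#|B :&: H| \in L) && (#|B :&: H| < #|B|)].
Proof.
move=> k2 FL /set0Pn[A0 A0F].
pose cap G := \bigcap_(A in G) A.
pose cl G := [set H in F | cap G \subset H].
pose P G := [&& G \subset F, G != set0 & #|cl G| <= k - 1].
have [A1 A1F A1max] : exists2 A1, A1 \in F & forall A, A \in F -> #|A| <= #|A1|.
  by case: (arg_maxnP (fun A => #|A|) A0F) => A1 A1F A1max; exists A1.
(* By maximality of its size, [A1] is the only member of [F] containing [A1]. *)
have P0 : P [set A1].
  rewrite /P sub1set A1F /=; apply/andP; split.
    by apply/set0Pn; exists A1; rewrite inE.
  rewrite (@leq_trans #|[set A1]|) ?cards1 ?subn_gt0 //.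
  rewrite -(cards1 A1); apply/subset_leq_card/subsetP => H.
  rewrite !inE /cap big_set1 => /andP[HF sA1H].
  by rewrite eq_sym eqEcard sA1H A1max.
case: (arg_minnP (fun G => #|cap G|) P0) => G /and3P[sGF G0 clG] Gmin.
have sGcl : G \subset cl G.
  apply/subsetP => H HG; rewrite inE (subsetP sGF) //=; exact: bigcap_inf.
have cap_cl : cap (cl G) = cap G.
  apply/eqP; rewrite eqEsubset; apply/andP; split.
    by apply/bigcapsP => H /(subsetP sGcl); apply: bigcap_inf.
  by apply/bigcapsP => H; rewrite inE => /andP[].
(* Passing to [cl G] keeps the intersection and ensures that no remaining member of [F] contains
   it. *)
exists (cl G); rewrite /= -/(cap _) cap_cl; split=> //.
- by apply/subsetP => H; rewrite inE => /andP[].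
- by apply: contraNneq G0 => clG0; rewrite -subset0 -clG0.
move=> H; rewrite !inE negb_and => /andP[nH HF].
have nGH : ~~ (cap G \subset H) by move: nH; rewrite HF.
have ltGH : #|cap G :&: H| < #|cap G|.
  apply: proper_card; rewrite properE subsetIl /=.
  by apply: contra nGH => /subset_trans -> //; apply: subsetIr.
rewrite ltGH andbT.
have capH : cap (H |: cl G) = cap G :&: H.
  by rewrite /cap bigcap_setU big_set1 -/(cap _) cap_cl setIC.
have sHF : H |: cl G \subset F.
  rewrite subUset sub1set HF; by apply/subsetP => A; rewrite inE => /andP[].
have kcl : k <= #|cl (H |: cl G)|.
  rewrite leqNgt; apply/negP => ltk.
  have /Gmin : P (H |: cl G).
    rewrite /P sHF /=; apply/andP; split.
      by apply/set0Pn; exists H; rewrite !inE eqxx.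
    by rewrite -ltnS subn1 (prednK (ltnW k2)).
  by rewrite capH leqNgt ltGH.
have sHcl : H |: cl G \subset cl (H |: cl G).
  apply/subsetP => A AH; rewrite inE (subsetP sHF) //=; exact: bigcap_inf.
have cHk : #|H |: cl G| <= k.
  rewrite cardsU1 -[X in _ <= X](subnKC (ltnW k2)).
  exact: leq_add (leq_b1 _) clG.
have [|B [sB1 sB2 cB]] := subset_card_extension (k := k) sHcl.
  by rewrite cHk.
suff -> : cap G :&: H = cap B.
  apply: FL cB; apply: subset_trans sB2 _.
  by apply/subsetP => A; rewrite inE => /andP[].
rewrite -capH; apply/eqP; rewrite eqEsubset; apply/andP; split.
  by apply/bigcapsP => A /(subsetP sB2); rewrite inE => /andP[].
by apply/bigcapsP => A /(subsetP sB1); apply: bigcap_inf.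
Qed.

Lemma triangular_pairs L F :
  2 <= k -> kwise_intersecting k L F ->
  exists ps : seq ({set 'I_n} * {set 'I_n}),
    [/\ #|F| <= (k - 1) * size ps,
        all (fun p => (p.1 \in F) && (p.2 \subset p.1)) ps &
        pairwise (fun p q => (#|p.2 :&: q.1| \in L)
                             && (#|p.2 :&: q.1| < #|p.2|)) ps].
Proof.
move=> k2; have [m] := ubnP #|F|; elim: m F => // m IHm F ltFm FL.
have [->|F0] := eqVneq F set0; first by exists [::]; rewrite cards0.
have [G [sGF G0 cG GH]] := critical_subfamily k2 FL F0.
have /set0Pn[A AG] := G0.
have cFG : #|F| = #|G| + #|F :\: G|.
  by rewrite cardsDS // subnKC // subset_leq_card.
have [||ps [cps aps pps]] := IHm (F :\: G).
- have : 0 < #|G| by rewrite card_gt0.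
  lia.
- by apply: kwise_intersectingS FL; apply: subsetDl.
(* Any [A] in [G] can serve as first component: later pairs are tested only against the intersection
   of [G]. *)
exists ((A, \bigcap_(B in G) B) :: ps); split => /=.
- by rewrite mulnS cFG leq_add.
- rewrite (subsetP sGF) // bigcap_inf //=; apply: sub_all aps => p.
  by rewrite inE => /andP[/andP[_ ->] ->].
rewrite pps andbT; apply: sub_all aps => p /andP[pFG _].
exact: GH.
Qed.

Lemma card_kwise_intersecting L F S :
  2 <= k -> kwise_intersecting k L F -> (forall A, A \in F -> S \subset A) ->
  #|F| <= (k - 1) * \sum_(0 <= i < (size L).+1) 'C(n - #|S|, i).
Proof.
move=> k2 FL SF; have [ps [cF aps pps]] := triangular_pairs k2 FL.
apply: leq_trans cF _; rewrite leq_mul2l; apply/orP; right.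
have -> : n - #|S| = #|~: S| by rewrite -[X in X - _](card_ord n) -(cardsC S) addKn.
apply: triangular_pairs_bound pps; apply: sub_all aps => p.
by case/andP=> /SF-> ->.
Qed.

(** Besides [A0], one member of [F] omitting [x] suffices for each point [x] of [A0]; when there is
    none, the default [A0] adds nothing. *)
Lemma same_intersection_subfamily F A0 : A0 \in F ->
  exists G : {set {set 'I_n}}, [/\ G \subset F, A0 \in G, #|G| <= #|A0|.+1 &
    \bigcap_(A in G) A = \bigcap_(A in F) A].
Proof.
move=> A0F.
pose f x := odflt A0 [pick A in F | x \notin A].
have fF x : f x \in F by rewrite /f; case: pickP => //= A /andP[].
have sGF : A0 |: (f @: A0) \subset F.
  rewrite subUset sub1set A0F; by apply/subsetP => _ /imsetP[x _ ->].
exists (A0 |: (f @: A0)); split=> //; first exact: setU11.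
  by rewrite cardsU1 -add1n leq_add ?leq_b1 ?leq_imset_card.
apply/eqP; rewrite eqEsubset andbC; apply/andP; split.
  by apply/bigcapsP => A /(subsetP sGF); apply: bigcap_inf.
apply/subsetP => x /bigcapP xG; apply/bigcapP => A AF.
have xA0 : x \in A0 by apply: xG; rewrite setU11.
have := xG (f x); rewrite !inE imset_f // orbT => /(_ isT).
rewrite /f; case: pickP => [B /andP[_ /negbTE->] //|nF _].
by have := nF A; rewrite AF /= => /negbFE.
Qed.

Lemma card_family_cover F T r : (forall A, A \in F -> r <= #|A :&: T|) ->
  #|F| <= \sum_(S in [set S : {set 'I_n} | S \subset T & #|S| == r])
            #|[set A in F | S \subset A]|.
Proof.
move=> FT.
under eq_bigr => S _ do (rewrite -sum1_card; under eq_bigl => A do rewrite inE).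
rewrite -sum1_card (exchange_big_dep (mem F)) /=; last by move=> S A _ /andP[].
apply: leq_sum => A AF.
have [|S [_ ST cS]] := subset_card_extension (k := r) (sub0set (A :&: T)).
  by rewrite cards0 FT.
rewrite (bigD1 S) //= inE AF cS eqxx andbT.
by move: ST; rewrite subsetI => /andP[-> ->].
Qed.

End KwiseIntersecting.

(** * Binomial estimate and conclusion *)

Lemma sum_bin_shift_leq c s N : c * s <= N ->
  c * \sum_(0 <= i < s) 'C(N.-1, i) <= \sum_(0 <= i < s.+1) 'C(N, i).
Proof.
move=> csN; rewrite [X in _ <= X]big_nat_recl //=.
apply: leq_trans (leq_addl _ _); rewrite big_distrr /=.
rewrite !big_nat; apply: leq_sum => i /andP[_ lt_is].
(* As [i.+1 * 'C(N, i.+1) = N * 'C(N.-1, i)], the termwise bound follows from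
   [c * i.+1 <= c * s <= N]. *)
rewrite -(@leq_pmul2l i.+1) // -mul_bin_diag mulnA leq_mul2r.
by rewrite (leq_trans _ csN) ?orbT // mulnC leq_mul2l lt_is orbT.
Qed.

Theorem theorem3p5 (n k s : nat) (l : s.-tuple nat) (F : {set {set 'I_n}})
  (k_ge2 : 2 <= k) (s_gt0 : 0 < s) (l_incr : sorted ltn l)
  (F_int : kwise_intersecting k l F) :
  let l1 := head 0 l in
  let h := max_size F in
  ('C(h ^ 2 + h, l1.+1) + 1) * s + l1 <= n ->
  #|F| <= (k - 1) * \sum_(0 <= i < s.+1) 'C(n - l1, i).
Proof.
move=> l1 h n_large.
(* With fewer than [k] members, the term [i = 0] alone gives the bound; otherwise every small
   subfamily extends to [k] members, as [l1_cap] requires. *)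
have [ltFk|lekF] := ltnP #|F| k.
  rewrite big_nat_recl // bin0 (@leq_trans (k - 1)) ?leq_pmulr //.
  by rewrite subn1 -ltnS prednK // (leq_trans _ k_ge2).
have l1_min : all (leq l1) l.
  rewrite /l1; case: (tval l) l_incr => //= a t /(order_path_min ltn_trans) at_.
  by rewrite leqnn; apply: sub_all at_ => b; apply: ltnW.
have l1_cap (G : {set {set 'I_n}}) :
    G \subset F -> #|G| <= k -> l1 <= #|\bigcap_(A in G) A|.
  move=> sGF cG; have [|x /(allP l1_min)] := kwise_intersecting_sub F_int sGF.
    by rewrite cG.
  exact: leq_trans.
have [l1F|ltFl1] := leqP l1 #|\bigcap_(A in F) A|.
  have [|S [_ SF <-]] :=
      subset_card_extension (k := l1) (sub0set (\bigcap_(A in F) A)).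
    by rewrite cards0.
  rewrite -(size_tuple l); apply: card_kwise_intersecting F_int _ => // A AF.
  by apply: subset_trans SF _; apply: bigcap_inf.
have /set0Pn[A0 A0F] : F != set0 by rewrite -card_gt0; lia.
have le_h A : A \in F -> #|A| <= h by move=> AF; apply: (leq_bigmax_cond A AF).
have [G [sGF A0G cG capG]] := same_intersection_subfamily A0F.
pose T := cover G.
have cT : #|T| <= h ^ 2 + h.
  have [leT _] := leq_card_cover G; apply: leq_trans leT _.
  apply: (@leq_trans (\sum_(A in G) h)).
    by apply: leq_sum => A /(subsetP sGF)/le_h.
  rewrite sum_nat_const -mulnn -mulSnr leq_mul2r; apply/orP; right.
  by apply: leq_trans cG _; rewrite ltnS le_h.
(* If A met T in exactly l1 points, then A :&: T would equal every A :&: B with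
   B in G, hence lie in the intersection of F, which has fewer than l1 points. *)
have FT A : A \in F -> l1.+1 <= #|A :&: T|.
  move=> AF; rewrite ltnNge; apply/negP => leAT.
  move: ltFl1; rewrite ltnNge => /negP[].
  have AB B : B \in G -> l1 <= #|A :&: B|.
    move=> BG; have := l1_cap [set A; B].
    rewrite bigcap_setU !big_set1; apply.
      by rewrite subUset !sub1set AF (subsetP sGF).
    (* The case [A = B] is included, [[set A; B]] then having one element. *)
    by rewrite cards2; case: (A != B); rewrite // ltnW.
  have sAT B : B \in G -> A :&: T \subset B.
    move=> BG; have sABT : A :&: B \subset A :&: T.
      by rewrite setIS // (bigcup_sup B).
    have /eqP <- : A :&: B == A :&: T.
      by rewrite eqEcard sABT (leq_trans leAT) ?AB.
    exact: subsetIr.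
  apply: leq_trans (AB A0 A0G) _; rewrite -capG.
  apply: subset_leq_card; apply: (@subset_trans _ _ (A :&: T)).
    by rewrite setIS // (bigcup_sup A0).
  by apply/bigcapsP.
(* Intersections of sets containing [S] have more than [l1] points, so the value [l1] drops out of
   [l]. *)
have tail_int (S : {set 'I_n}) : #|S| = l1.+1 ->
    kwise_intersecting k (behead l) [set A in F | S \subset A].
  move=> cS B sBF cB; have /F_int/(_ cB) : B \subset F.
    by apply: subset_trans sBF _; apply/subsetP => A; rewrite inE => /andP[].
  have : l1 < #|\bigcap_(A in B) A|.
    rewrite -cS; apply/subset_leq_card/bigcapsP => A /(subsetP sBF).
    by rewrite inE => /andP[].
  rewrite /l1; case: (tval l) => //= a t lt_a.
  by rewrite inE gtn_eqF.
have card_star (S : {set 'I_n}) : #|S| = l1.+1 ->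
    #|[set A in F | S \subset A]| <=
      (k - 1) * \sum_(0 <= i < s) 'C((n - l1).-1, i).
  have size_behead_l : (size (behead l)).+1 = s.
    by rewrite size_behead size_tuple prednK.
  move=> cS; rewrite -subnS -cS -size_behead_l.
  apply: card_kwise_intersecting (tail_int S cS) _ => // A.
  by rewrite inE => /andP[].
apply: leq_trans (card_family_cover FT) _.
apply: (@leq_trans (\sum_(S in [set S : {set 'I_n} | S \subset T & #|S| == l1.+1])
    (k - 1) * \sum_(0 <= i < s) 'C((n - l1).-1, i))).
  by apply: leq_sum => S; rewrite inE => /andP[_ /eqP/card_star].
rewrite sum_nat_const cards_draws mulnCA leq_mul2l; apply/orP; right.
(* Here [c] is ['C(h ^ 2 + h, l1.+1)] and [N] is [n - l1]; the bound on [n] gives [c * s <= N]. *)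
apply: leq_trans (leq_mul (leq_bin2l l1.+1 cT) (leqnn _)) (sum_bin_shift_leq _).
apply: leq_trans (leq_sub2r l1 n_large).
by rewrite addnK leq_mul2r leq_addr orbT.
Qed.
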